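(* All values of the function $R$ on $\mathbb{N}^r$ are nonnegative. Furthermore, let $p$ be a prime and $e_1,\ldots,e_r\in\mathbb{N}$ with $e:=e_1=\cdots=e_s>e_{s+1}\ge\cdots\ge e_r\ge 1$ for some $1\le s\le r$. Then $R(p^{e_1},\ldots,p^{e_r})=0$ if and only if $e>1$ and either $s=1$, or $s$ is odd and $p=2$.
   Context: For $n\in\mathbb{N}$ and $k\in\mathbb{Z}$, $c_n(k)=\sum_{1\le j\le n,\ \gcd(j,n)=1}\exp(2\pi i jk/n)$ is the Ramanujan sum. For $r\in\mathbb{N}$ and $m_1,\ldots,m_r\in\mathbb{N}$ with $m=\operatorname{lcm}(m_1,\ldots,m_r)$, $R(m_1,\ldots,m_r)=\sum_{1\le k\le m,\ \gcd(k,m)=1}c_{m_1}(k-1)\cdots c_{m_r}(k-1)$. *)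

(* Defs.v *)
From HB Require Import structures.
From mathcomp Require Import all_boot all_order all_algebra.
From mathcomp Require Import complex.
From mathcomp Require Import reals sequences exp trigo.

Set Implicit Arguments.
Unset Strict Implicit.
Unset Printing Implicit Defensive.

Import Order.TTheory GRing.Theory Num.Theory.
Local Open Scope ring_scope.
Local Open Scope complex_scope.

Definition cexp (R : realType) (z : R[i]) : R[i] :=
  (expR (complex.Re z))%:C * (cos (complex.Im z) +i* sin (complex.Im z)).

(* c_n(k); meaningful for n >= 1. *)
Definition ramanujan_sum (R : realType) (n : nat) (k : int) : R[i] :=
  \sum_(1 <= j < n.+1 | coprime j n)
    cexp (2%:R * pi%:C * 'i * j%:R * k%:~R / n%:R).

(* R(m_1, ..., m_r), with m_(i+1) encoded as [m i]. *)
Definition ramanujan_R (R : realType) (r : nat) (m : 'I_r -> nat) : R[i] :=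
  let M := (\big[lcmn/1]_(i < r) m i)%N in
  \sum_(1 <= k < M.+1 | coprime k M)
    \prod_(i < r) ramanujan_sum R (m i) (k%:Z - 1).

(* Main.v *)
Require Import Defs.
From HB Require Import structures.
From mathcomp Require Import all_boot all_order all_algebra.
From mathcomp Require Import complex.
From mathcomp Require Import reals sequences exp trigo.
From mathcomp Require Import ring lra zify.

Import Order.TTheory GRing.Theory Num.Theory.
Local Open Scope ring_scope.

(** Nonnegativity.  For units k, l modulo m the kernel
    [c_m(k - l) = \sum_j zeta^(jk) * conj (zeta^(jl))] is positive semidefinite,
    and so is the product of such kernels.  Since [c_m(u n) = c_m(n)] for every
    unit u, the sum of [\prod_i c_{m_i}(k - l)] over the units k modulo M does
    not depend on the unit l; hence [phi(M) * R(m_1, ..., m_r)] is the sum of a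
    positive semidefinite kernel over all pairs of units.

    Vanishing.  Put [q = p^(e-1)].  As [c_{p^e}(n)] vanishes unless q divides n,
    only the [k = 1 + t q] with [0 <= t < p] contribute, and R is a positive
    multiple of [(p-1)^s + N (-1)^s], where N counts the [t > 0] for which
    [1 + t q] is prime to p: [N = p - 1] if [e > 1], and [N = p - 2] if [e = 1]. *)

(** * Sums over units and over multiples *)

Lemma sum_units_shift (V : nmodType) (n : nat) (F : nat -> V) :
  (0 < n)%N -> F n = F 0%N ->
  \sum_(1 <= k < n.+1 | coprime k n) F k = \sum_(k < n | coprime k n) F k.
Proof.
move=> n_gt0 Fn; rewrite big_mkcond big_nat_recr //= [RHS]big_mkcond /=.
rewrite -(big_mkord xpredT (fun k => if coprime k n then F k else 0)).
(* The end indices [n] and [0] trade places: both have gcd [n] with [n]. *)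
by rewrite [RHS]big_ltn //= addrC Fn /coprime gcdnn gcd0n.
Qed.

(** Multiplication by a unit permutes the residues modulo [n] and preserves coprimality to [n]. *)
Lemma sum_units_mul (V : nmodType) (n u : nat) (F : nat -> V) :
  (0 < n)%N -> coprime u n -> (forall k, F (k %% n)%N = F k) ->
  \sum_(1 <= k < n.+1 | coprime k n) F (u * k)%N =
  \sum_(1 <= k < n.+1 | coprime k n) F k.
Proof.
move=> n_gt0 cun Fmod.
rewrite (sum_units_shift _ _ (fun k => F (u * k)%N)) //; last first.
  by rewrite -Fmod modnMl muln0.
rewrite sum_units_shift //; last by rewrite -Fmod modnn.
pose h (k : 'I_n) := Ordinal (ltn_pmod (u * k) n_gt0).
have h_inj : injective h.
  move=> k l /(congr1 val) /= /eqP.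
  wlog le_lk : k l / (l <= k)%N.
    by move=> IH; case: (leqP l k) => [/IH //|/ltnW /IH H]; rewrite eq_sym => /H.
  rewrite eqn_mod_dvd ?leq_mul // -mulnBr Gauss_dvdr 1?coprime_sym //.
  rewrite -eqn_mod_dvd // !modn_small // => /eqP kl; exact: val_inj.
rewrite [RHS](reindex_inj h_inj) /=.
apply: eq_big => [k | k _]; last by rewrite Fmod.
by rewrite coprime_modl coprimeMl cun.
Qed.

Lemma sum_dvdn (V : nmodType) (a b : nat) (F : nat -> V) : (0 < b)%N ->
  \sum_(0 <= k < a * b | (b %| k)%N) F k = \sum_(0 <= t < a) F (t * b)%N.
Proof.
move=> b_gt0; rewrite big_mkcond big_nat_mul; apply: eq_bigr => t _.
rewrite big_ltn ?ltn_mul2r ?b_gt0 ?ltnSn //= dvdn_mull // big_nat big1 ?addr0 //.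
move=> k /andP[lk ku]; case: ifP => // /dvdnP[q kq]; move: lk ku.
by rewrite kq !ltn_mul2r b_gt0 /= ltnS => /leq_trans H /H; rewrite ltnn.
Qed.

(** * Positive semidefinite kernels and nonnegativity *)

Section RootsOfUnity.
Variable C : numClosedFieldType.
Implicit Types (z : C) (n k l : nat).

(** Positive semidefiniteness, given as a finite sum of rank-one kernels so that closure under
    products is explicit. *)
Definition gram (K : nat -> nat -> C) :=
  exists s : seq (nat -> C), forall k l, K k l = \sum_(f <- s) f k * (f l)^*.

(** Schur's product theorem: the pointwise product of two rank-one kernels has rank one. *)
Lemma gram_prod (I : Type) (s : seq I) (K : I -> nat -> nat -> C) :
  (forall i, gram (K i)) -> gram (fun k l => \prod_(i <- s) K i k l).
Proof.
move=> gK; elim: s => [|i s [t IH]].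
  exists [:: fun=> 1] => k l.
  by rewrite big_nil big_seq1 mul1r rmorph1.
have [q Kq] := gK i.
exists [seq (fun k => f.1 k * f.2 k) | f <- [seq (f, g) | f <- q, g <- t]] => k l.
rewrite big_cons Kq IH big_map big_allpairs big_distrlr /=.
by do 2!apply: eq_bigr => ? _; rewrite rmorphM mulrACA.
Qed.

(** Each rank-one term contributes the squared modulus of the sum of [f]. *)
Lemma gram_sum_ge0 (K : nat -> nat -> C) (s : seq nat) (P : pred nat) :
  gram K -> 0 <= \sum_(l <- s | P l) \sum_(k <- s | P k) K k l.
Proof.
case=> t Kt.
suff -> : \sum_(l <- s | P l) \sum_(k <- s | P k) K k l =
          \sum_(f <- t) (\sum_(k <- s | P k) f k) * (\sum_(k <- s | P k) f k)^*.
  by apply: sumr_ge0 => f _; rewrite mul_conjC_ge0.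
under eq_bigr => l _ do under eq_bigr => k _ do rewrite Kt.
under eq_bigr => l _ do rewrite exchange_big.
rewrite exchange_big; apply: eq_bigr => f _ /=.
rewrite rmorph_sum mulr_sumr; apply: eq_bigr => l _.
by rewrite mulr_suml.
Qed.

(** This is [c_n(k)] when [z = exp(2 pi i / n)]. *)
Definition ram z n k := \sum_(1 <= j < n.+1 | coprime j n) z ^+ (j * k).

(* For [z ^+ n = 1] this is [c_n(k - l)], without subtracting in [nat]. *)
Definition ramker z n k l :=
  \sum_(1 <= j < n.+1 | coprime j n) z ^+ (j * k) * (z ^+ (j * l))^*.

Lemma gram_ramker z n : gram (ramker z n).
Proof.
exists [seq (fun k => z ^+ (j * k)) | j <- index_iota 1 n.+1 & coprime j n].
by move=> k l; rewrite big_map big_filter.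
Qed.

Lemma conjC_unity_root z n : (0 < n)%N -> z ^+ n = 1 -> z^* = z^-1.
Proof.
move=> n_gt0 zn; rewrite invC_norm.
suff -> : `|z| = 1 by rewrite expr1n invr1 mul1r.
by apply/eqP; rewrite -(pexpr_eq1 n_gt0) // -normrX zn normr1.
Qed.

Lemma ramkerD z n k l : (0 < n)%N -> z ^+ n = 1 -> ramker z n (k + l) l = ram z n k.
Proof.
move=> n_gt0 zn; apply: eq_bigr => j _.
rewrite rmorphXn /= (conjC_unity_root _ _ n_gt0 zn) mulnDr exprD exprVn mulfK //.
rewrite expf_neq0 //; apply/eqP => z0; move/eqP: zn.
by rewrite z0 expr0n gtn_eqF // eq_sym oner_eq0.
Qed.

(** The unit [u] is absorbed by the summation index [j]. *)
Lemma ramker_mul z n u k l : (0 < n)%N -> z ^+ n = 1 -> coprime u n ->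
  ramker z n (u * k) (u * l) = ramker z n k l.
Proof.
move=> n_gt0 zn cun.
rewrite /ramker -(sum_units_mul _ n u (fun j => z ^+ (j * k) * (z ^+ (j * l))^*)) //.
  by apply: eq_bigr => j _; rewrite !(mulnCA j) !mulnA.
move=> j; rewrite -(expr_mod _ zn) modnMml (expr_mod _ zn); congr (_ * _^*).
by rewrite -(expr_mod _ zn) modnMml (expr_mod _ zn).
Qed.

Lemma ramker_mod z n m k l : z ^+ n = 1 -> (n %| m)%N ->
  ramker z n (k %% m) l = ramker z n k l.
Proof.
move=> zn nm; apply: eq_bigr => j _; congr (_ * _).
by rewrite -(expr_mod _ zn) -modnMmr modn_dvdm // modnMmr (expr_mod _ zn).
Qed.

Lemma sum_prod_ram_ge0 (r : nat) (m : 'I_r -> nat) (z : 'I_r -> C) (M : nat) :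
  (0 < M)%N -> (forall i, m i %| M)%N -> (forall i, z i ^+ m i = 1) ->
  0 <= \sum_(1 <= k < M.+1 | coprime k M) \prod_(i < r) ram (z i) (m i) k.-1.
Proof.
move=> M_gt0 mM zm.
have m_gt0 i : (0 < m i)%N by apply: dvdn_gt0 (mM i).
pose G k l := \prod_(i < r) ramker (z i) (m i) k l.
have -> : \sum_(1 <= k < M.+1 | coprime k M) \prod_(i < r) ram (z i) (m i) k.-1 =
          \sum_(1 <= k < M.+1 | coprime k M) G k 1%N.
  rewrite big_nat_cond [RHS]big_nat_cond; apply: eq_bigr => k /andP[/andP[k_gt0 _] _].
  by apply: eq_bigr => i _; rewrite -(ramkerD _ _ _ 1) // addn1 prednK.
set S := \sum_(_ <= _ < _ | _) _.
(* Replacing [k] by [l * k] turns [G k l] into [G (l * k) (l * 1) = G k 1]. *)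
have sumG l : coprime l M -> \sum_(1 <= k < M.+1 | coprime k M) G k l = S.
  move=> clM; rewrite -(sum_units_mul _ M l) //; last first.
    by move=> k; apply: eq_bigr => i _; rewrite (ramker_mod _ _ M).
  apply: eq_bigr => k _; apply: eq_bigr => i _.
  by rewrite -{2}[l]muln1 ramker_mul // (coprime_dvdr (mM i)).
have: 0 <= \sum_(1 <= l < M.+1 | coprime l M) \sum_(1 <= k < M.+1 | coprime k M) G k l.
  by apply: gram_sum_ge0; apply: gram_prod => i; apply: gram_ramker.
(* The double sum is phi([M]) times [S], and phi([M]) is positive because [l = 1] is counted. *)
rewrite (eq_bigr (fun=> 1 * S)) => [|l /sumG ->]; last by rewrite mul1r.
rewrite -mulr_suml pmulr_rge0 // big_mkcond big_ltn ?ltnS //= coprime1n.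
rewrite ltr_pwDl ?ltr01 //; apply: sumr_ge0 => l _.
by case: ifP; rewrite ?ler01.
Qed.

(** * Evaluation at prime powers *)

Lemma sum_prim_root z n k : n.-primitive_root z ->
  \sum_(0 <= j < n) z ^+ (j * k) = if (n %| k)%N then n%:R else 0.
Proof.
move=> zP; rewrite big_mkord.
under eq_bigr => j _ do rewrite mulnC exprM.
have := eq_prim_root_expr zP k 0; rewrite expr0 mod0n => zk.
rewrite /dvdn -zk; case: eqP => [-> | /eqP zk1].
  by under eq_bigr => j _ do rewrite expr1n; rewrite sumr_const card_ord.
(* Geometric sum: its product with [z ^+ k - 1] is [z ^+ (k * n) - 1 = 0]. *)
have := subrX1 (z ^+ k) n.
rewrite exprAC (prim_expr_order zP) expr1n subrr => /esym /eqP.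
by rewrite mulf_eq0 subr_eq0 (negbTE zk1) => /eqP.
Qed.

(** The full sum over residues, minus the multiples of [p]; on the latter [z ^+ p] acts as a
    primitive root of order [p ^ e]. *)
Lemma ram_prime_power z p e k : prime p -> (p ^ e.+1).-primitive_root z ->
  ram z (p ^ e.+1) k =
  (if (p ^ e.+1 %| k)%N then (p ^ e.+1)%:R else 0) -
  (if (p ^ e %| k)%N then (p ^ e)%:R else 0).
Proof.
move=> p_pr zP; have p_gt0 := prime_gt0 p_pr.
rewrite /ram sum_units_shift ?expn_gt0 ?p_gt0 //; last first.
  by rewrite exprM (prim_expr_order zP) expr1n mul0n expr0.
rewrite -(big_mkord (fun j => coprime j (p ^ e.+1)) (fun j => z ^+ (j * k))).
rewrite -(sum_prim_root _ _ k zP).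
have zpP : (p ^ e).-primitive_root (z ^+ p).
  have pe_dvd : (p ^ e %| p ^ e.+1)%N by rewrite dvdn_exp2l.
  have := dvdn_prim_root zP pe_dvd.
  by rewrite expnS mulnK ?expn_gt0 ?p_gt0.
have multE : \sum_(0 <= j < p ^ e.+1 | (p %| j)%N) z ^+ (j * k) =
             \sum_(0 <= j < p ^ e) (z ^+ p) ^+ (j * k).
  rewrite expnSr sum_dvdn //; apply: eq_bigr => j _.
  by rewrite -exprM mulnAC mulnC.
rewrite -(sum_prim_root _ _ k zpP) -multE [X in _ = X - _](bigID (fun j => p %| j)%N) /=.
rewrite addrAC subrr add0r.
by apply: eq_bigl => j; rewrite coprime_sym coprime_pexpl // prime_coprime.
Qed.

Lemma sum_coprime_succ p E (x : C) : prime p ->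
  \sum_(1 <= t < p) (if coprime (t * p ^ E).+1 (p ^ E.+1) then x else 0) =
  x *+ (if E == 0%N then p.-2 else p.-1).
Proof.
move=> p_pr; have p_gt1 := prime_gt1 p_pr; have p_gt0 := prime_gt0 p_pr.
under eq_bigr => t _ do rewrite coprime_pexpr // coprime_sym prime_coprime //.
case: eqP => [-> | /eqP]; last first.
  rewrite -lt0n => E_gt0; rewrite -subn1 -sumr_const_nat; apply: eq_bigr => t _.
  rewrite -addn1 dvdn_addr; last by rewrite dvdn_mull // dvdn_exp.
  by rewrite dvdn1 gtn_eqF.
(* For [E = 0] only the last index [t = p - 1] fails, as then [t + 1 = p]. *)
case: p p_gt1 {p_pr p_gt0} => [|[|p]] // _.
rewrite big_nat_recr //= expn0 !muln1 dvdnn addr0.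
have -> : x *+ p = \sum_(1 <= t < p.+1) x by rewrite sumr_const_nat subn1.
rewrite big_nat [RHS]big_nat.
by apply: eq_bigr => t /andP[_ tp]; rewrite muln1 gtnNdvd.
Qed.

Lemma sum_prod_ram_prime_power (r p : nat) (e : 'I_r -> nat) (z : 'I_r -> C)
    (E s : nat) :
  prime p -> (0 < s <= r)%N ->
  (forall i : 'I_r, (i < s)%N -> e i = E.+1) ->
  (forall i : 'I_r, (s <= i)%N -> (0 < e i <= E)%N) ->
  (forall i, (p ^ e i).-primitive_root (z i)) ->
  \sum_(1 <= k < (p ^ E.+1).+1 | coprime k (p ^ E.+1))
    \prod_(i < r) ram (z i) (p ^ e i) k.-1 =
  (\prod_(i < r | (s <= i)%N) (p ^ e i - p ^ (e i).-1)%:R) * (p ^ E)%:R ^+ s *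
  (p.-1%:R ^+ s + (-1) ^+ s *+ (if E == 0%N then p.-2 else p.-1)).
Proof.
move=> p_pr /andP[s_gt0 sr] eE elt zP; have p_gt0 := prime_gt0 p_pr.
have q_gt0 : (0 < p ^ E)%N by rewrite expn_gt0 p_gt0.
pose T n := \prod_(i < r) ram (z i) (p ^ e i) n.
set B := \prod_(i < r | _) _.
have top (i : 'I_r) n : (i < s)%N -> ram (z i) (p ^ e i) n =
    (if (p ^ E.+1 %| n)%N then (p ^ E.+1)%:R else 0) -
    (if (p ^ E %| n)%N then (p ^ E)%:R else 0).
  by move=> /eE ei; have := zP i; rewrite ei; apply: ram_prime_power.
(* The factor of index [0] has the top exponent and already vanishes. *)
have T0 n : ~~ (p ^ E %| n)%N -> T n = 0.
  move=> qn; rewrite /T (bigD1 (Ordinal (leq_trans s_gt0 sr))) //= top //.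
  rewrite (negbTE qn) ifF ?subr0 ?mul0r //; apply: contraNF qn.
  by apply: dvdn_trans; rewrite dvdn_exp2l.
(* Only the [s] top factors depend on [t]; each lower modulus divides [p ^ E], so its factor is
   phi([p ^ e i]). *)
have TB t : T (t * p ^ E)%N =
    (if (p %| t)%N then (p ^ E)%:R * p.-1%:R else - (p ^ E)%:R) ^+ s * B.
  rewrite /T (bigID (fun i : 'I_r => (i < s)%N)) /=; congr (_ * _).
    rewrite big_ord_narrow -[X in _ = _ ^+ X]card_ord -prodr_const.
    apply: eq_bigr => i _; rewrite top //= expnS dvdn_pmul2r // dvdn_mull //.
    case: ifP => _; last by rewrite sub0r.
    by rewrite natrM -{1}(prednK p_gt0) -natr1 mulrDl mul1r addrK mulrC.
  apply: eq_big => [i | i]; first by rewrite -leqNgt.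
  rewrite -leqNgt => si; have /andP[ei_gt0 eiE] := elt _ si; have := zP i.
  case: (e i) ei_gt0 eiE => [//|f] _ fE /= /ram_prime_power -> //; have fE' := ltnW fE.
  rewrite !dvdn_mull ?dvdn_exp2l // natrB //.
  by rewrite leq_exp2l ?prime_gt1.
rewrite big_add1 /=.
rewrite (eq_bigr T) //.
rewrite (eq_bigl (fun n => true && coprime n.+1 (p ^ E.+1))) // big_mkcondr /=.
rewrite (bigID (fun n => p ^ E %| n)%N) /= addrC big1 ?add0r; last first.
  by move=> n /T0 ->; case: ifP.
(* Among [t < p] only [t = 0] is a multiple of [p], so it is split off. *)
have T0E := TB 0%N; rewrite mul0n dvdn0 in T0E.
rewrite {1}expnS sum_dvdn // big_ltn // mul0n coprime1n T0E.
rewrite (eq_big_nat _ _ (F2 := fun t => if coprime (t * p ^ E).+1 (p ^ E.+1)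
    then (- (p ^ E)%:R) ^+ s * B else 0)); last first.
  by move=> t /andP[t_gt0 tp]; rewrite TB gtnNdvd.
rewrite sum_coprime_succ // exprMn exprNn.
move: (_ ^+ s) (_ ^+ s) (_ ^+ s) (if _ then _ else _) => a b c N.
rewrite mulrDr mulrnAr [a * c]mulrC.
by rewrite !(mulrC _ B) !mulrA.
Qed.

End RootsOfUnity.

(** * Transfer to the complex exponential *)

Local Open Scope complex_scope.

Definition zeta (R : realType) (n : nat) : R[i] :=
  cos (pi *+ 2 / n%:R) +i* sin (pi *+ 2 / n%:R).

Lemma expr_cos_sin (R : realType) (x : R) (k : nat) :
  (cos x +i* sin x) ^+ k = cos (x * k%:R) +i* sin (x * k%:R).
Proof.
elim: k => [|k IH]; first by rewrite expr0 mulr0 cos0 sin0.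
rewrite exprS IH -natr1 mulrDr mulr1 addrC cosD sinD.
by apply/eqP; rewrite eq_complex /=; apply/andP; split; apply/eqP; ring.
Qed.

Lemma zeta_primitive (R : realType) (n : nat) :
  (0 < n)%N -> n.-primitive_root (zeta R n).
Proof.
move=> n_gt0; have n_gt0' : 0 < n%:R :> R by rewrite ltr0n.
apply/andP; split => //; apply/forallP => i; apply/eqP.
rewrite unity_rootE expr_cos_sin.
case: (ltngtP i.+1 n) => [lt_in | | ->].
- apply/negbTE/eqP => -[cos1 _].
  suff: cos (pi *+ 2 / n%:R * i.+1%:R) != 1 :> R by rewrite cos1 eqxx.
  (* With [x = pi * (i + 1) / n] strictly between [0] and [pi], cos(2x) = 1 - 2 sin(x)^2 < 1. *)
  rewrite 2!mulrnAl (cos_mulr2n (pi / n%:R * i.+1%:R)).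
  have := cos2Dsin2 (pi / n%:R * i.+1%:R : R).
  set x := _ / _ * _ => cs.
  have x_gt0 : 0 < x by rewrite !mulr_gt0 ?invr_gt0 ?ltr0n ?pi_gt0.
  have x_lt : x < pi.
    by rewrite /x mulrAC -mulrA gtr_pMr ?pi_gt0 // ltr_pdivrMr // mul1r ltr_nat.
  have sx : 0 < sin x by rewrite sin_gt0_pi ?x_gt0.
  have : 0 < sin x ^+ 2 by rewrite exprn_gt0.
  by move=> s2; apply/eqP => c1; lra.
- by rewrite ltnNge ltn_ord.
- by rewrite divfK ?(gt_eqF n_gt0') // cos2pi sin2pi eqxx.
Qed.

Lemma ramanujan_sum_ram (R : realType) (n k : nat) :
  ramanujan_sum R n k%:Z = ram _ (zeta R n) n k.
Proof.
apply: eq_bigr => j _; rewrite expr_cos_sin.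
have -> : 2%:R * pi%:C * 'i * j%:R * (k%:Z)%:~R / n%:R =
    0 +i* (pi *+ 2 / n%:R * (j * k)%:R) :> R[i].
  have CE (x : R) : 0 +i* x = x%:C * 'i.
    by apply/eqP; rewrite eq_complex /= !mul0r !mulr0 mulr1 subrr addr0 !eqxx.
  rewrite CE natrM !rmorphM /= fmorphV !rmorph_nat; ring.
by rewrite /cexp /= expR0 mul1r.
Qed.

Lemma ramanujan_R_ram (R : realType) (r : nat) (m : 'I_r -> nat) (M : nat) :
  (\big[lcmn/1]_(i < r) m i)%N = M ->
  ramanujan_R R m = \sum_(1 <= k < M.+1 | coprime k M)
    \prod_(i < r) ram _ (zeta R (m i)) (m i) k.-1.
Proof.
rewrite /ramanujan_R => ->.
rewrite big_nat_cond [RHS]big_nat_cond; apply: eq_bigr => k /andP[/andP[k_gt0 _] _].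
apply: eq_bigr => i _; rewrite -ramanujan_sum_ram; congr ramanujan_sum.
by rewrite -{1}(prednK k_gt0) -addn1 PoszD addrK.
Qed.

(** * The vanishing criterion *)

Lemma expn_add_sign_eq0 (F : numDomainType) (p s E : nat) : (1 < p)%N -> (0 < s)%N ->
  (p.-1%:R ^+ s + (-1) ^+ s *+ (if E == 0%N then p.-2 else p.-1) = 0 :> F) <->
  (0 < E)%N /\ (s = 1%N \/ odd s /\ p = 2%N).
Proof.
case: p => [|[|p]] // _ s_gt0 /=.
(* For even [s] the first term is positive and the second nonnegative. *)
rewrite -signr_odd -natrX; case: (boolP (odd s)) => os; last first.
  rewrite expr0 -natrD; split => [/eqP | [_ [s1 | []//]]]; last by rewrite s1 in os.
  by rewrite pnatr_eq0 addn_eq0 expn_eq0.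
(* For odd [s] and the original [p], the equation is (p-1)^s = N. Since (p-1)^s >= p-1, the value N
   = p-2 is excluded; N = p-1 forces [s = 1] or p-1 = 1. *)
rewrite expr1 mulNrn; split.
  move/eqP; rewrite subr_eq0 eqr_nat; case: (E =P 0%N) => [_ | /eqP E0] /eqP pE.
    have := leq_pexp2l (ltn0Sn p) s_gt0; rewrite pE expn1; lia.
  split; first by rewrite lt0n.
  case: p pE => [|p] pE; [by right | left].
  by apply/eqP; rewrite -(eqn_exp2l s 1 (isT : 1 < p.+2)%N) pE expn1.
case=> E_gt0 H; rewrite gtn_eqF //; apply/eqP; rewrite subr_eq0 eqr_nat; apply/eqP.
case: H => [-> | [_ [->]]]; [by rewrite expn1 | by rewrite exp1n].
Qed.

Theorem corollary13 (R : realType) (r : nat) (hr : (1 <= r)%N) :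
  (forall m : 'I_r -> nat, (forall i, (1 <= m i)%N) ->
     0 <= ramanujan_R R m) /\
  (forall (p : nat) (e : 'I_r -> nat) (E s : nat),
     prime p ->
     (1 <= s <= r)%N ->
     (forall i : 'I_r, (i < s)%N -> e i = E) ->
     (forall i : 'I_r, (s <= i)%N -> (e i < E)%N) ->
     (forall i j : 'I_r, (i <= j)%N -> (e j <= e i)%N) ->
     (forall i : 'I_r, (1 <= e i)%N) ->
     (ramanujan_R R (fun i : 'I_r => p ^ e i)%N = 0 <->
      (1 < E)%N /\ (s = 1%N \/ (odd s /\ p = 2%N)))).
Proof.
split=> [m m_gt0 | p e E s p_pr sr eE elt _ e_gt0].
  rewrite (ramanujan_R_ram _ _ _ _ erefl).
  apply: sum_prod_ram_ge0 => [|i|i].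
  - by elim/big_ind: _ => // a b a_gt0 b_gt0; rewrite lcmn_gt0 a_gt0.
  - exact: biglcmn_sup.
  - exact/prim_expr_order/zeta_primitive.
have /andP[s_gt0 s_le] := sr; have p_gt1 := prime_gt1 p_pr.
pose i0 := Ordinal (leq_trans s_gt0 s_le).
have ei0 : e i0 = E by apply: eE.
have e_le i : (e i <= E)%N.
  by case: (leqP s i) => [/elt/ltnW | /eE ->].
case: E => [|E] in eE elt ei0 e_le *; first by have := e_gt0 i0; rewrite ei0.
(* The lcm is the top power, attained at [i0]; the exponent called e in the statement is now
   [E.+1]. *)
rewrite (ramanujan_R_ram _ _ _ (p ^ E.+1)); last first.
  apply/eqP; rewrite eqn_dvd; apply/andP; split.
    by apply/dvdn_biglcmP => i _; rewrite dvdn_exp2l.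
  by rewrite -[X in (p ^ X %| _)%N]ei0; apply: (biglcmn_sup i0).
rewrite (sum_prod_ram_prime_power _ _ _ _ _ E s) //; first last.
- by move=> i; apply: zeta_primitive; rewrite expn_gt0 prime_gt0.
- by move=> i si; rewrite e_gt0 -ltnS elt.
have -> : (1 < E.+1)%N = (0 < E)%N by [].
rewrite -(expn_add_sign_eq0 R[i]) //.
set A := _ * _ ^+ s; set X := _ + _ *+ _.
(* [A] collects the nonzero factors: a power of [p ^ E] and the phi([p ^ e i]) of the lower
   indices. *)
suff A0 : A != 0.
  split=> [/eqP | ->]; last by rewrite mulr0.
  by rewrite mulf_eq0 (negbTE A0) => /eqP.
apply: mulf_neq0; last by rewrite expf_neq0 // pnatr_eq0 -lt0n expn_gt0 prime_gt0.
apply/prodf_neq0 => i _; rewrite pnatr_eq0 subn_eq0 -ltnNge ltn_exp2l //.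
by rewrite prednK.
Qed.
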